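(* Let $CHV$ be the loop Heisenberg-Virasoro Lie conformal algebra over $\mathbb{C}$, i.e. the free $\mathbb{C}[\partial]$-module with $\mathbb{C}[\partial]$-basis $\{L_i,H_i\mid i\in\mathbb{Z}\}$ and $\lambda$-brackets $[L_i\,{}_\lambda\,L_j]=(\partial+2\lambda)L_{i+j}$, $[L_i\,{}_\lambda\,H_j]=(\partial+\lambda)H_{i+j}$, $[H_i\,{}_\lambda\,L_j]=\lambda H_{i+j}$, $[H_i\,{}_\lambda\,H_j]=0$. Let ${\rm CDer}(CHV)$ be the vector space of all conformal derivations of $CHV$ and ${\rm CInn}(CHV)$ the subspace of inner conformal derivations. Let $\mathbb{C}^\infty$ be the space of sequences $\vec a=(a_c)_{c\in\mathbb{Z}}$ of complex numbers with $a_c=0$ for all but finitely many $c$, and identify $\vec a\in\mathbb{C}^\infty$ with the conformal derivation $D_{\vec a}$ of $CHV$ determined by $(D_{\vec a})_\lambda(L_i)=\sum_{c\in\mathbb{Z}}a_cH_{i+c}$ and $(D_{\vec a})_\lambda(H_i)=0$ for all $i\in\mathbb{Z}$. Then $${\rm CDer}(CHV)={\rm CInn}(CHV)\oplus\mathbb{C}^\infty.$$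
   Context: A Lie conformal algebra is a $\mathbb{C}[\partial]$-module $A$ with a linear map $A\otimes A\to A[\lambda]=\mathbb{C}[\lambda]\otimes A$, $a\otimes b\mapsto[a\,{}_\lambda\,b]$ (the $\lambda$-bracket), satisfying $[\partial a\,{}_\lambda\,b]=-\lambda[a\,{}_\lambda\,b]$, $[a\,{}_\lambda\,\partial b]=(\partial+\lambda)[a\,{}_\lambda\,b]$, $[a\,{}_\lambda\,b]=-[b\,{}_{-\lambda-\partial}\,a]$, and $[a\,{}_\lambda\,[b\,{}_\mu\,c]]=[[a\,{}_\lambda\,b]\,{}_{\lambda+\mu}\,c]+[b\,{}_\mu\,[a\,{}_\lambda\,c]]$. $\lambda$-brackets given on a $\mathbb{C}[\partial]$-basis are extended to the whole module by the first two identities. A conformal derivation of $A$ is a linear map $\phi_\lambda:A\to A[\lambda]$ such that $\phi_\lambda(\partial v)=(\partial+\lambda)\phi_\lambda(v)$ and $\phi_\lambda([a\,{}_\mu\,b])=[(\phi_\lambda a)\,{}_{\lambda+\mu}\,b]+[a\,{}_\mu\,(\phi_\lambda b)]$ for all $a,b,v\in A$. For $x\in A$ the map ${\rm ad}_x$ defined by $({\rm ad}_x)_\lambda y=[x\,{}_\lambda\,y]$ is a conformal derivation; conformal derivations of this form are called inner. *)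

(* Defs.v *)
From HB Require Import structures.
From mathcomp Require Import all_boot all_order all_algebra.
From mathcomp Require Import finmap monalg.
From mathcomp Require Import classical_sets.
From mathcomp Require Import ring.
Set Implicit Arguments.
Unset Strict Implicit.
Unset Printing Implicit Defensive.
Import GRing.Theory.
Local Open Scope ring_scope.
Local Open Scope classical_set_scope.

(* [polymod V] is V[x] = K[x] (x) V, for V a module over K: the finitely       *)
(* supported sequences of elements of V (v@_n is the coefficient of x^n), with *)
(* its structure of K[x]-module.                                              *)
Definition polymod (K : comNzRingType) (V : lmodType K) : Type :=
  {malg V[nat]}.

Section PolyMod.
Variables (K : comNzRingType) (V : lmodType K).

HB.instance Definition _ := GRing.Zmodule.copy (polymod V) {malg V[nat]}.

Implicit Types (p q : {poly K}) (v w : polymod V).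

Definition polymod_scale p v : polymod V :=
  \sum_(i < size p) \sum_(k <- msupp (v : {malg V[nat]}))
    << p`_i *: v@_k *g (i + k)%N >>.

Lemma polymodP v w : (forall n, v@_n = w@_n) -> v = w.
Proof. by move=> /malgP. Qed.

Lemma pcoefD n v w : (v + w)@_n = v@_n + w@_n.
Proof. exact: (raddfD (@mcoeff nat V n)). Qed.

Lemma pcoef0 n : (0 : polymod V)@_n = 0.
Proof. exact: (raddf0 (@mcoeff nat V n)). Qed.

Lemma sum_msupp (I : choiceType) (G M : zmodType) (g : {malg G[I]})
    (d : {fset I}) (F : I -> G -> M) : (msupp g `<=` d)%fset ->
  (forall k, F k 0 = 0) ->
  \sum_(k <- msupp g) F k g@_k = \sum_(k <- d) F k g@_k.
Proof.
move=> sgd F0; apply/big_fset_incl => // k _ /mcoeff_outdom ->; exact: F0.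
Qed.

Lemma pcoef_scale p v n :
  (polymod_scale p v)@_n = \sum_(i < n.+1) p`_i *: v@_(n - i)%N.
Proof.
rewrite /polymod_scale.
have cS := raddf_sum (@mcoeff nat V n).
rewrite cS /=.
pose G (i : nat) := if (i <= n)%N then p`_i *: v@_(n - i)%N else 0.
have E (i : nat) : mcoeff n (\sum_(k <- msupp (v : {malg V[nat]}))
    << p`_i *: v@_k *g (i + k)%N >>) = G i.
  rewrite cS /= /G.
  under eq_bigr do rewrite mcoeffU.
  have [le_in|lt_ni] := leqP i n; last first.
    rewrite big1 // => k _; rewrite mulrb ifN // neq_ltn orbC ltn_addr //.
  have [|niv] := boolP ((n - i)%N \in msupp (v : {malg V[nat]})).
    move=> h; rewrite (big_fsetD1 _ h) /= subnKC // eqxx mulr1n.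
    rewrite big_seq big1 ?addr0 // => k; rewrite in_fsetD1 => /andP[nk _].
    rewrite mulrb ifN //; apply: contraNneq nk => <-; by rewrite addKn.
  rewrite (mcoeff_outdom niv) scaler0 big_seq big1 // => k kv.
  rewrite mulrb ifN //; apply: contraNneq niv => <-; by rewrite addKn.
under eq_bigr do rewrite E.
transitivity (\sum_(i < maxn (size p) n.+1) G i).
  rewrite (big_ord_widen _ G (leq_maxl (size p) n.+1)) big_mkcond /=.
  apply: eq_bigr => i _; case: ltnP => // h.
  by rewrite /G nth_default // scale0r if_same.
rewrite (big_ord_widen _ (fun i => p`_i *: v@_(n - i)%N) (leq_maxr (size p) n.+1)).
by rewrite [RHS]big_mkcond.
Qed.

Lemma polymod_scaleA p q v :
  polymod_scale p (polymod_scale q v) = polymod_scale (p * q) v.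
Proof.
apply: polymodP => n; rewrite !pcoef_scale.
under eq_bigr do rewrite pcoef_scale scaler_sumr.
under [RHS]eq_bigr do rewrite coefM scaler_suml.
pose F (i j : nat) := p`_i *: (q`_j *: v@_(n - i - j)%N).
transitivity (\sum_(i < n.+1) \sum_(j < n.+1 | (i <= j)%N) F i (j - i)%N).
  apply: eq_bigr => i _.
  rewrite (eq_bigr (fun j : 'I__ => F i j)) //.
  rewrite -(big_mkord xpredT (F i)).
  rewrite -(big_mkord (fun j => i <= j)%N (fun j => F i (j - i)%N)).
  rewrite [RHS](eq_bigl (fun j : nat => xpredT j && (i <= j)%N)) //.
  rewrite -(@big_nat_widenl _ _ _ i 0 n.+1 xpredT (fun j => F i (j - i)%N)) //.
  have := @big_addn _ 0 +%R 0 n.+1 i xpredT (fun j => F i (j - i)%N).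
  rewrite add0n => ->; rewrite subSn; last by rewrite -ltnS.
  by apply: eq_bigr => j _; rewrite addnK.
rewrite (exchange_big_dep xpredT) //=.
apply: eq_bigr => j _.
rewrite (big_ord_widen n.+1 (fun i => (p`_i * q`_(j - i)) *: v@_(n - j)%N)) //.
apply: eq_big => [i|i]; rewrite ?ltnS // => ij.
by rewrite /F scalerA -subnDA subnKC.
Qed.

Lemma polymod_scale1 : left_id 1 polymod_scale.
Proof.
move=> v; apply: polymodP => n; rewrite pcoef_scale big_ord_recl big1 => [|i _].
  by rewrite coef1 scale1r subn0 addr0.
by rewrite coef1 scale0r.
Qed.

Lemma polymod_scaleDr : right_distributive polymod_scale +%R.
Proof.
move=> p v w; apply: polymodP => n; rewrite pcoefD !pcoef_scale -big_split.
by apply: eq_bigr => i _; rewrite pcoefD scalerDr.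
Qed.

Lemma polymod_scaleDl v :
  {morph polymod_scale^~ v : p q / p + q}.
Proof.
move=> p q; apply: polymodP => n; rewrite pcoefD !pcoef_scale -big_split.
by apply: eq_bigr => i _; rewrite coefD scalerDl.
Qed.

HB.instance Definition _ := GRing.Zmodule_isLmodule.Build {poly K} (polymod V)
  polymod_scaleA polymod_scale1 polymod_scaleDr polymod_scaleDl.

End PolyMod.

Section PolyModTheory.
Variables (K : comNzRingType) (V : lmodType K).

Definition polymodC (v : V) : polymod V := << v *g 0%N >>.

(* sum_n x^n v_n |-> sum_n s^n f(v_n) : the coefficients are mapped by f and  *)
(* the variable x is replaced by the scalar s.                               *)
Definition polymod_subst (S : comNzRingType) (M : lmodType S) (f : V -> M)
    (s : S) (x : polymod V) : M :=
  \sum_(n <- msupp (x : {malg V[nat]})) s ^+ n *: f x@_n.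

Lemma polymodCD : {morph polymodC : v w / v + w}.
Proof. exact: (raddfD (@mkmalgU nat V 0%N)). Qed.

Lemma polymod_scaleU (p : K) i v k :
  (p%:P * 'X^i) *: (<< v *g k >> : polymod V) = << p *: v *g (i + k)%N >>.
Proof.
apply: polymodP => n; rewrite [LHS]pcoef_scale mcoeffU.
have [le_in|lt_ni] := leqP i n; last first.
  rewrite big1 => [|j _]; first by rewrite mulrb ifN // gtn_eqF // ltn_addr.
  rewrite coefCM coefXn (ltn_eqF (leq_trans (ltn_ord j) lt_ni)) mulr0.
  by rewrite scale0r.
have lin : (i < n.+1)%N by [].
rewrite (bigD1 (Ordinal lin)) //= big1 => [|j /eqP/val_eqP/= /negbTE nj].
  rewrite addr0 coefCM coefXn eqxx mulr1 mcoeffU -scalerMnr; congr (_ *+ _).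
  by rewrite -{2}(subnKC le_in) eqn_add2l.
by rewrite coefCM coefXn nj mulr0 scale0r.
Qed.

Section Subst.
Variables (S : comNzRingType) (M : lmodType S) (f : V -> M) (s : S).
Hypothesis fD : {morph f : v w / v + w}.

Let f0 : f 0 = 0.
Proof. by apply: (addrI (f 0)); rewrite -fD !addr0. Qed.

Lemma substw (d : {fset nat}) (x : polymod V) :
  (msupp (x : {malg V[nat]}) `<=` d)%fset ->
  polymod_subst f s x = \sum_(n <- d) s ^+ n *: f x@_n.
Proof.
move=> sxd; apply: (sum_msupp (F := fun n v => s ^+ n *: f v)) => // k.
by rewrite f0 scaler0.
Qed.

Lemma substD : {morph polymod_subst f s : x y / x + y}.
Proof.
move=> x y; pose d := (msupp (x : {malg V[nat]}) `|` msupp (y : {malg V[nat]}))%fset.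
rewrite (@substw d) ?msuppD_le // (@substw d x) ?fsubsetUl //.
rewrite (@substw d y) ?fsubsetUr // -big_split; apply: eq_bigr => n _.
by rewrite pcoefD fD scalerDr.
Qed.

Lemma subst0 : polymod_subst f s 0 = 0.
Proof. by apply: (addrI (polymod_subst f s 0)); rewrite -substD !addr0. Qed.

Lemma substN x : polymod_subst f s (- x) = - polymod_subst f s x.
Proof. by apply/eqP; rewrite -addr_eq0 -substD addNr subst0. Qed.

Lemma subst_sum I r (P : pred I) (F : I -> polymod V) :
  polymod_subst f s (\sum_(i <- r | P i) F i) =
  \sum_(i <- r | P i) polymod_subst f s (F i).
Proof. by apply: (big_morph _ substD subst0). Qed.

Lemma substU v n : polymod_subst f s << v *g n >> = s ^+ n *: f v.
Proof.
rewrite (@substw [fset n]%fset) ?msuppU_le // big_seq_fset1.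
by rewrite mcoeffU eqxx mulr1n.
Qed.

Lemma substC v : polymod_subst f s (polymodC v) = f v.
Proof. by rewrite substU expr0 scale1r. Qed.

Lemma substZ (p : K) (t : S) i x : (forall v, f (p *: v) = t *: f v) ->
  polymod_subst f s ((p%:P * 'X^i) *: x) = (t * s ^+ i) *: polymod_subst f s x.
Proof.
move=> fp; have -> : x = \sum_(n <- msupp (x : {malg V[nat]})) << x@_n *g n >>.
  exact: (monalgE (x : {malg V[nat]})).
rewrite scaler_sumr !subst_sum scaler_sumr; apply: eq_bigr => n _.
by rewrite polymod_scaleU !substU fp !scalerA exprD; congr (_ *: _); ring.
Qed.

Lemma substZC (p : K) (t : S) x : (forall v, f (p *: v) = t *: f v) ->
  polymod_subst f s (p%:P *: x) = t *: polymod_subst f s x.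
Proof. by move=> /(@substZ p t 0 x); rewrite !expr0 !mulr1. Qed.

Lemma substX x : polymod_subst f s ('X *: x) = s *: polymod_subst f s x.
Proof.
have := @substZ 1 1 1 x; rewrite !expr1 polyC1 !mul1r; apply => v.
by rewrite !scale1r.
Qed.

End Subst.

Lemma subst_fD (S : comNzRingType) (M : lmodType S) (f g : V -> M) (s : S) x :
  polymod_subst (fun v => f v + g v) s x =
  polymod_subst f s x + polymod_subst g s x.
Proof.
by rewrite /polymod_subst -big_split; apply: eq_bigr => n _; rewrite scalerDr.
Qed.

Lemma subst_fZ (S : comNzRingType) (M : lmodType S) (f : V -> M) (t s : S) x :
  polymod_subst (fun v => t *: f v) s x = t *: polymod_subst f s x.
Proof.
rewrite /polymod_subst scaler_sumr; apply: eq_bigr => n _.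
by rewrite !scalerA mulrC.
Qed.

Lemma eq_subst (S : comNzRingType) (M : lmodType S) (f g : V -> M) (s : S) x :
  f =1 g -> polymod_subst f s x = polymod_subst g s x.
Proof. by move=> fg; apply: eq_bigr => n _; rewrite fg. Qed.

Lemma polymodCZ (p : K) v : polymodC (p *: v) = p%:P *: polymodC v.
Proof. by rewrite -[p%:P]mulr1 -(expr0 'X) polymod_scaleU addn0. Qed.

End PolyModTheory.

(* A C[d]-module A (d is the derivation) is an lmodType {poly C}, d acting as *)
(* 'X. Then A[x] = polymod A is a module over C[d][x] = {poly {poly C}}, where *)
(*     d = 'X%:P and x = 'X,                                                  *)
(* and A[lam][mu] = polymod (polymod A) is a module over C[d][lam][mu], where *)
(*     d = 'X%:P%:P, lam = 'X%:P and mu = 'X.                                 *)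
(* Scalars from C are the constant polynomials c%:P, c%:P%:P, ...             *)
Section LieConformal.
Variables (C : fieldType) (A : lmodType {poly C}).

Definition lam : {poly {poly {poly C}}} := 'X%:P.
Definition mu : {poly {poly {poly C}}} := 'X.

(* sum_n x^n v_n |-> sum_n s^n v_n; thus [a_s b] is at2 s (br a b). *)
Definition at2 (s : {poly {poly {poly C}}}) (x : polymod A) :
    polymod (polymod A) :=
  polymod_subst (fun v => polymodC (polymodC v)) s x.

Definition conf_linear (phi : A -> polymod A) : Prop :=
  forall (c : C) v w, phi (c%:P *: v + w) = c%:P%:P *: phi v + phi w.

Definition subspace (U : set (A -> polymod A)) : Prop :=
  U (fun=> 0) /\
  forall (c : C) phi psi, U phi -> U psi ->
    U (fun v => c%:P%:P *: phi v + psi v).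

(* internal direct sum W = U1 (+) U2 of C-subspaces *)
Definition direct_sum (W U1 U2 : set (A -> polymod A)) : Prop :=
  [/\ subspace U1, subspace U2,
      W = [set (fun v => phi v + psi v) | phi in U1 & psi in U2] &
      U1 `&` U2 = [set (fun=> 0)]].

Variable br : A -> A -> polymod A.

Definition conf_sesquilinear : Prop :=
  (forall a b, br ('X *: a) b = - 'X *: br a b) /\
  (forall a b, br a ('X *: b) = ('X%:P + 'X) *: br a b).

(* [b_{-x-d} a] = sum_n (-x-d)^n b_(n)a, where [b_x a] = sum_n x^n b_(n)a *)
Definition conf_skew : Prop :=
  forall a b, br a b = - polymod_subst (@polymodC _ A) (- 'X - 'X%:P) (br b a).

(* A nested bracket such as [a_lam [b_mu c]] = sum_n mu^n [a_lam b_(n)c] is      *)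
(* computed coefficientwise in the inner bracket.                             *)
Definition conf_jacobi : Prop := forall a b c,
  polymod_subst (fun y => at2 lam (br a y)) mu (br b c) =
    polymod_subst (fun x => at2 (lam + mu) (br x c)) lam (br a b) +
    polymod_subst (fun y => at2 mu (br b y)) lam (br a c).

End LieConformal.

Arguments lam {C}.
Arguments mu {C}.

HB.mixin Record isLieConformal (C : fieldType) A
    of GRing.Lmodule {poly C} A := {
  lbracket : A -> A -> polymod A;
  lbracket_linearl : forall b, conf_linear (lbracket^~ b);
  lbracket_linearr : forall a, conf_linear (lbracket a);
  lbracket_sesquilinear : conf_sesquilinear lbracket;
  lbracket_skew : conf_skew lbracket;
  lbracket_jacobi : conf_jacobi lbracket
}.

#[short(type="lieConformalType")]
HB.structure Definition LieConformal (C : fieldType) :=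
  { A of GRing.Lmodule {poly C} A & isLieConformal C A }.

Section ConformalDerivations.
Variables (C : fieldType) (A : lieConformalType C).
Implicit Types phi : A -> polymod A.

Definition conformal_derivation phi : Prop :=
  [/\ conf_linear phi,
      forall v, phi ('X *: v) = ('X%:P + 'X) *: phi v &
      forall a b,
        polymod_subst (fun y => at2 lam (phi y)) mu (lbracket a b) =
          polymod_subst (fun x => at2 (lam + mu) (lbracket x b)) lam (phi a) +
          polymod_subst (fun y => at2 mu (lbracket a y)) lam (phi b)].

Definition conf_ad (x : A) : A -> polymod A := fun y => lbracket x y.

Definition CDer : set (A -> polymod A) := [set phi | conformal_derivation phi].

Definition CInn : set (A -> polymod A) := [set conf_ad x | x in setT].

End ConformalDerivations.

Arguments CDer {C} A.
Arguments CInn {C} A.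

Section CHV.
Variable C : fieldType.

(* The free C[d]-module on L_i = inl i and H_i = inr i, i in Z. *)
Definition CHV : Type := {malg {poly C}[(int + int)%type]}.

HB.instance Definition _ :=
  GRing.Lmodule.copy CHV {malg {poly C}[(int + int)%type]}.

Definition CHV_L (i : int) : CHV := << inl i >>.
Definition CHV_H (i : int) : CHV := << inr i >>.

(* p(d) |-> p(s) *)
Definition subd (s : {poly {poly C}}) (p : {poly C}) : {poly {poly C}} :=
  p^:P \Po s.

(* sum_k p_k(d) e_k |-> sum_k p_k(s) f(e_k) *)
Definition CHV_ext (s : {poly {poly C}}) (f : int + int -> polymod CHV)
    (x : CHV) : polymod CHV :=
  \sum_(k <- msupp (x : {malg {poly C}[(int + int)%type]}))
    subd s x@_k *: f k.

Definition CHV_gen_bracket (k l : int + int) : polymod CHV :=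
  match k, l with
  | inl i, inl j => ('X%:P + 'X *+ 2) *: polymodC (CHV_L (i + j))
  | inl i, inr j => ('X%:P + 'X) *: polymodC (CHV_H (i + j))
  | inr i, inl j => 'X *: polymodC (CHV_H (i + j))
  | inr _, inr _ => 0
  end.

(* [p(d) e_k _x q(d) e_l] = p(-x) q(d + x) [e_k _x e_l] *)
Definition CHV_bracket (x y : CHV) : polymod CHV :=
  CHV_ext (- 'X) (fun k => CHV_ext ('X%:P + 'X) (CHV_gen_bracket k) y) x.

Lemma subdD s : {morph subd s : p q / p + q}.
Proof. by move=> p q; rewrite /subd rmorphD /= comp_polyD. Qed.

Lemma subdM s : {morph subd s : p q / p * q}.
Proof. by move=> p q; rewrite /subd rmorphM /= comp_polyM. Qed.

Lemma subdC s (c : C) : subd s c%:P = c%:P%:P.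
Proof. by rewrite /subd map_polyC comp_polyC. Qed.

Lemma subdX s : subd s 'X = s.
Proof. by rewrite /subd map_polyX comp_polyX. Qed.

Section Ext.
Variables (s : {poly {poly C}}) (f : int + int -> polymod CHV).

Lemma CHV_extw (d : {fset int + int}) (x : CHV) :
  (msupp (x : {malg {poly C}[(int + int)%type]}) `<=` d)%fset ->
  CHV_ext s f x = \sum_(k <- d) subd s x@_k *: f k.
Proof.
move=> sxd; apply: (sum_msupp (F := fun k p => subd s p *: f k)) => // k.
by rewrite subdC !polyC0 scale0r.
Qed.

Lemma CHV_extD : {morph CHV_ext s f : x y / x + y}.
Proof.
move=> x y; pose d := (msupp (x : {malg {poly C}[(int + int)%type]}) `|`
  msupp (y : {malg {poly C}[(int + int)%type]}))%fset.
rewrite (@CHV_extw d) ?msuppD_le // (@CHV_extw d x) ?fsubsetUl //.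
rewrite (@CHV_extw d y) ?fsubsetUr // -big_split; apply: eq_bigr => n _.
rewrite (_ : (x + y)@_n = x@_n + y@_n) ?subdD ?scalerDl //.
exact: (raddfD (@mcoeff _ {poly C} n)).
Qed.

Lemma CHV_extZ p x : CHV_ext s f (p *: x) = subd s p *: CHV_ext s f x.
Proof.
rewrite (@CHV_extw (msupp (x : {malg {poly C}[(int + int)%type]}))).
  rewrite scaler_sumr; apply: eq_bigr => k _.
  by rewrite (mcoeffZ p) subdM scalerA.
exact: (msuppZ_le p).
Qed.

Lemma CHV_ext_gen k : CHV_ext s f (<< k >> : CHV) = f k.
Proof.
rewrite (@CHV_extw [fset k]%fset) ?msuppU_le // big_seq_fset1.
by rewrite mcoeffU eqxx mulr1n subdC !polyC1 scale1r.
Qed.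

End Ext.

Lemma CHV_extfD s f g x :
  CHV_ext s (fun k => f k + g k) x = CHV_ext s f x + CHV_ext s g x.
Proof.
by rewrite /CHV_ext -big_split; apply: eq_bigr => n _; rewrite scalerDr.
Qed.

Lemma CHV_extfZ s t f x :
  CHV_ext s (fun k => t *: f k) x = t *: CHV_ext s f x.
Proof.
rewrite /CHV_ext scaler_sumr; apply: eq_bigr => n _.
by rewrite !scalerA mulrC.
Qed.

Lemma eq_CHV_ext s f g x : f =1 g -> CHV_ext s f x = CHV_ext s g x.
Proof. by move=> fg; apply: eq_bigr => n _; rewrite fg. Qed.

Lemma CHV_bracketDl z : {morph CHV_bracket^~ z : x y / x + y}.
Proof. exact: CHV_extD. Qed.

Lemma CHV_bracketZl p x y :
  CHV_bracket (p *: x) y = subd (- 'X) p *: CHV_bracket x y.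
Proof. exact: CHV_extZ. Qed.

Lemma CHV_bracketDr z : {morph CHV_bracket z : x y / x + y}.
Proof.
move=> x y; rewrite /CHV_bracket -CHV_extfD.
by apply: eq_CHV_ext => k; rewrite CHV_extD.
Qed.

Lemma CHV_bracketZr p x y :
  CHV_bracket x (p *: y) = subd ('X%:P + 'X) p *: CHV_bracket x y.
Proof.
rewrite /CHV_bracket -CHV_extfZ.
by apply: eq_CHV_ext => k; rewrite CHV_extZ.
Qed.

Lemma CHV_bracket_gen k l :
  CHV_bracket (<< k >> : CHV) (<< l >> : CHV) = CHV_gen_bracket k l.
Proof. by rewrite /CHV_bracket !CHV_ext_gen. Qed.

Lemma CHV_bracketLL i j : CHV_bracket (CHV_L i) (CHV_L j) =
  ('X%:P + 'X *+ 2) *: polymodC (CHV_L (i + j)).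
Proof. exact: CHV_bracket_gen. Qed.

Lemma CHV_bracketLH i j : CHV_bracket (CHV_L i) (CHV_H j) =
  ('X%:P + 'X) *: polymodC (CHV_H (i + j)).
Proof. exact: CHV_bracket_gen. Qed.

Lemma CHV_bracketHL i j : CHV_bracket (CHV_H i) (CHV_L j) =
  'X *: polymodC (CHV_H (i + j)).
Proof. exact: CHV_bracket_gen. Qed.

Lemma CHV_bracketHH i j : CHV_bracket (CHV_H i) (CHV_H j) = 0.
Proof. exact: CHV_bracket_gen. Qed.

Lemma CHV_ind (P : CHV -> Prop) :
  P 0 -> (forall x y, P x -> P y -> P (x + y)) ->
  (forall (c : C) x, P x -> P (c%:P *: x)) -> (forall x, P x -> P ('X *: x)) ->
  (forall i, P (CHV_L i)) -> (forall i, P (CHV_H i)) -> forall x, P x.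
Proof.
move=> P0 PD PC PX PL PH x.
have PZ (p : {poly C}) y : P y -> P (p *: y).
  move=> Py; elim/poly_ind: p => [|p c IH]; first by rewrite scale0r.
  by rewrite scalerDl mulrC -scalerA; apply: PD; [apply: PX|apply: PC].
have -> : x = \sum_(k <- msupp (x : {malg {poly C}[(int + int)%type]}))
    x@_k *: (<< k >> : CHV).
  rewrite [LHS](monalgE (x : {malg {poly C}[(int + int)%type]})).
  apply: eq_bigr => k _; apply/malgP => l.
  by rewrite (mcoeffZ x@_k) !mcoeffU mulr_natr.
apply: big_ind => // -[i|i] _; apply: PZ; [exact: PL|exact: PH].
Qed.

Lemma CHV_linear_ext (S : comNzRingType) (M : lmodType S) (F G : CHV -> M)
    (h : C -> S) (s : S) :
  {morph F : x y / x + y} -> {morph G : x y / x + y} ->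
  (forall c x, F (c%:P *: x) = h c *: F x) ->
  (forall c x, G (c%:P *: x) = h c *: G x) ->
  (forall x, F ('X *: x) = s *: F x) -> (forall x, G ('X *: x) = s *: G x) ->
  (forall i, F (CHV_L i) = G (CHV_L i)) ->
  (forall i, F (CHV_H i) = G (CHV_H i)) -> F =1 G.
Proof.
move=> FD GD FC GC FX GX FL FH; apply: CHV_ind => //.
- by apply: (addrI (F 0)); rewrite -FD addr0 -[LHS]addr0; congr (_ + _);
     apply: (addrI (G 0)); rewrite -GD !addr0.
- by move=> x y Fx Fy; rewrite FD GD Fx Fy.
- by move=> c x Fx; rewrite FC GC Fx.
- by move=> x Fx; rewrite FX GX Fx.
Qed.

Lemma CHV_bracketCl (c : C) x y :
  CHV_bracket (c%:P *: x) y = c%:P%:P *: CHV_bracket x y.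
Proof. by rewrite CHV_bracketZl subdC. Qed.

Lemma CHV_bracketCr (c : C) x y :
  CHV_bracket x (c%:P *: y) = c%:P%:P *: CHV_bracket x y.
Proof. by rewrite CHV_bracketZr subdC. Qed.

Lemma CHV_bracketXl x y :
  CHV_bracket ('X *: x) y = - 'X *: CHV_bracket x y.
Proof. by rewrite CHV_bracketZl subdX. Qed.

Lemma CHV_bracketXr x y :
  CHV_bracket x ('X *: y) = ('X%:P + 'X) *: CHV_bracket x y.
Proof. by rewrite CHV_bracketZr subdX. Qed.

Lemma CHV_bracket_linearl y : conf_linear (CHV_bracket^~ y).
Proof. by move=> c v w; rewrite CHV_bracketDl CHV_bracketCl. Qed.

Lemma CHV_bracket_linearr x : conf_linear (CHV_bracket x).
Proof. by move=> c v w; rewrite CHV_bracketDr CHV_bracketCr. Qed.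

Lemma CHV_bracket_sesquilinear : conf_sesquilinear CHV_bracket.
Proof.
by split=> [x y|x y]; [rewrite CHV_bracketXl|rewrite CHV_bracketXr].
Qed.

Let skw := polymod_subst (@polymodC _ CHV) (- 'X - 'X%:P).

Let skwD : {morph skw : x y / x + y}.
Proof. by apply: substD; apply: polymodCD. Qed.

Let skwN x : skw (- x) = - skw x.
Proof. by apply: substN; apply: polymodCD. Qed.

Let skwX x : skw ('X *: x) = (- 'X - 'X%:P) *: skw x.
Proof. by apply: substX; apply: polymodCD. Qed.

Let skwC (p : {poly C}) x : skw (p%:P *: x) = p%:P *: skw x.
Proof.
apply: substZC; first exact: polymodCD.
by move=> v; rewrite polymodCZ.
Qed.

Let skwv v : skw (polymodC v) = polymodC v.
Proof. by rewrite /skw substC //; apply: polymodCD. Qed.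

Let skw_gen m n v : skw (('X%:P *+ m + 'X *+ n) *: polymodC v) =
  ('X%:P *+ m + (- 'X - 'X%:P) *+ n) *: polymodC v.
Proof.
rewrite scalerDl skwD -polyCMn skwC skwv.
rewrite -[in X in skw (X *: _)]mulr_natl (_ : n%:R = (n%:R)%:P); last first.
  by rewrite polyC_natr.
rewrite -scalerA skwC skwX skwv scalerA -scalerDl; congr (_ *: _).
by rewrite polyC_natr mulr_natl.
Qed.

Lemma CHV_bracket_skew : conf_skew CHV_bracket.
Proof.
move=> a b; rewrite -/skw; move: a; apply: (@CHV_linear_ext {poly {poly C}} _
    (fun a => CHV_bracket a b) (fun a => - skw (CHV_bracket b a))
    (fun c => c%:P%:P) (- 'X)) => [||c x|c x|x|x|i|i].
- exact: CHV_bracketDl.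
- by move=> x y; rewrite CHV_bracketDr skwD opprD.
- exact: CHV_bracketCl.
- by rewrite CHV_bracketCr skwC scalerN.
- exact: CHV_bracketXl.
- rewrite CHV_bracketXr scalerDl skwD skwC skwX -scalerDl -scalerN.
  by congr (_ *: _); ring.
- move: b; apply: (@CHV_linear_ext {poly {poly C}} _
    (fun b => CHV_bracket (CHV_L i) b) (fun b => - skw (CHV_bracket b (CHV_L i)))
    (fun c => c%:P%:P) ('X%:P + 'X)) => [||c x|c x|x|x|j|j].
  + exact: CHV_bracketDr.
  + by move=> x y; rewrite CHV_bracketDl skwD opprD.
  + exact: CHV_bracketCr.
  + by rewrite CHV_bracketCl skwC scalerN.
  + exact: CHV_bracketXr.
  + rewrite CHV_bracketXl scaleNr skwN skwX opprK scalerN -scaleNr.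
    by congr (_ *: _); ring.
  + rewrite (CHV_bracketLL i j) (CHV_bracketLL j i) (skw_gen 1 2) -scaleNr.
    by rewrite [j + i]addrC; congr (_ *: _); rewrite mulr1n; ring.
  + rewrite CHV_bracketLH CHV_bracketHL skwX skwv -scaleNr [j + i]addrC.
    by congr (_ *: _); ring.
- move: b; apply: (@CHV_linear_ext {poly {poly C}} _
    (fun b => CHV_bracket (CHV_H i) b) (fun b => - skw (CHV_bracket b (CHV_H i)))
    (fun c => c%:P%:P) ('X%:P + 'X)) => [||c x|c x|x|x|j|j].
  + exact: CHV_bracketDr.
  + by move=> x y; rewrite CHV_bracketDl skwD opprD.
  + exact: CHV_bracketCr.
  + by rewrite CHV_bracketCl skwC scalerN.
  + exact: CHV_bracketXr.
  + rewrite CHV_bracketXl scaleNr skwN skwX opprK scalerN -scaleNr.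
    by congr (_ *: _); ring.
  + rewrite CHV_bracketLH CHV_bracketHL (skw_gen 1 1) -scaleNr [j + i]addrC.
    by congr (_ *: _); rewrite !mulr1n; ring.
  + by rewrite !CHV_bracketHH /skw subst0 ?oppr0 //; apply: polymodCD.
Qed.

Local Notation M2 := (polymod (polymod CHV)).
Local Notation "''d'" := ('X%:P%:P : {poly {poly {poly C}}}).
Let CC (v : CHV) : M2 := polymodC (polymodC v).

Let CCD : {morph CC : v w / v + w}.
Proof. by move=> v w; rewrite /CC !polymodCD. Qed.

Let CCZ (p : {poly C}) v : CC (p *: v) = p%:P%:P *: CC v.
Proof. by rewrite /CC !polymodCZ. Qed.

Section At.
Variable s : {poly {poly {poly C}}}.

Lemma at2D : {morph (@at2 C CHV s) : x y / x + y}.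
Proof. exact: substD. Qed.

Lemma at2X x : at2 s ('X *: x) = s *: at2 s x :> M2.
Proof. exact: substX. Qed.

Lemma at2Z (p : {poly C}) x : at2 s (p%:P *: x) = p%:P%:P *: at2 s x :> M2.
Proof. by apply: substZC => // v; rewrite -CCZ. Qed.

Lemma at2N x : at2 s (- x) = - at2 s x :> M2.
Proof. exact: substN. Qed.

Lemma at2v v : at2 s (polymodC v) = CC v :> M2.
Proof. exact: substC. Qed.

Lemma at20 : at2 s 0 = 0 :> M2.
Proof. exact: subst0. Qed.

End At.

Record tri_sesquilinear_for (S : comNzRingType) (M : lmodType S) (h : C -> S)
    (s1 s2 s3 : S) (T : CHV -> CHV -> CHV -> M) : Prop := {
  tri_D1 : forall b c, {morph (fun a => T a b c) : x y / x + y};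
  tri_D2 : forall a c, {morph (fun b => T a b c) : x y / x + y};
  tri_D3 : forall a b, {morph (fun c => T a b c) : x y / x + y};
  tri_C1 : forall b c k a, T (k%:P *: a) b c = h k *: T a b c;
  tri_C2 : forall a c k b, T a (k%:P *: b) c = h k *: T a b c;
  tri_C3 : forall a b k c, T a b (k%:P *: c) = h k *: T a b c;
  tri_X1 : forall b c a, T ('X *: a) b c = s1 *: T a b c;
  tri_X2 : forall a c b, T a ('X *: b) c = s2 *: T a b c;
  tri_X3 : forall a b c, T a b ('X *: c) = s3 *: T a b c
}.

Section Tri.
Variables (S : comNzRingType) (M : lmodType S) (h : C -> S) (s1 s2 s3 : S).
Local Notation tri_sesquilinear := (@tri_sesquilinear_for S M h s1 s2 s3).

Lemma tri_sesquilinearD T T' : tri_sesquilinear T -> tri_sesquilinear T' ->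
  tri_sesquilinear (fun a b c => T a b c + T' a b c).
Proof.
move=> hT hT'; split=> * /=.
- by move=> ? ? /=; rewrite (tri_D1 hT) (tri_D1 hT') addrACA.
- by move=> ? ? /=; rewrite (tri_D2 hT) (tri_D2 hT') addrACA.
- by move=> ? ? /=; rewrite (tri_D3 hT) (tri_D3 hT') addrACA.
- by rewrite (tri_C1 hT) (tri_C1 hT') scalerDr.
- by rewrite (tri_C2 hT) (tri_C2 hT') scalerDr.
- by rewrite (tri_C3 hT) (tri_C3 hT') scalerDr.
- by rewrite (tri_X1 hT) (tri_X1 hT') scalerDr.
- by rewrite (tri_X2 hT) (tri_X2 hT') scalerDr.
- by rewrite (tri_X3 hT) (tri_X3 hT') scalerDr.
Qed.

Lemma tri_sesquilinear_ext T T' : tri_sesquilinear T -> tri_sesquilinear T' ->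
  (forall k l m, T (<< k >> : CHV) (<< l >> : CHV) (<< m >> : CHV) =
                 T' (<< k >> : CHV) (<< l >> : CHV) (<< m >> : CHV)) ->
  forall a b c, T a b c = T' a b c.
Proof.
move=> hT hT' e a b c.
have e3 k l z : T (<< k >> : CHV) (<< l >> : CHV) z =
                T' (<< k >> : CHV) (<< l >> : CHV) z.
  move: z; apply: (CHV_linear_ext (tri_D3 hT _ _) (tri_D3 hT' _ _)
    (tri_C3 hT _ _) (tri_C3 hT' _ _) (tri_X3 hT _ _) (tri_X3 hT' _ _)) => i;
  exact: e.
have e2 k y z : T (<< k >> : CHV) y z = T' (<< k >> : CHV) y z.
  move: y; apply: (CHV_linear_ext (tri_D2 hT _ _) (tri_D2 hT' _ _)
    (tri_C2 hT _ _) (tri_C2 hT' _ _) (tri_X2 hT _ _) (tri_X2 hT' _ _)) => i;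
  exact: e3.
move: a; apply: (CHV_linear_ext (tri_D1 hT _ _) (tri_D1 hT' _ _)
  (tri_C1 hT _ _) (tri_C1 hT' _ _) (tri_X1 hT _ _) (tri_X1 hT' _ _)) => i;
exact: e2.
Qed.

End Tri.

Let tri_sesquilinear : (CHV -> CHV -> CHV -> M2) -> Prop :=
  tri_sesquilinear_for (fun k => k%:P%:P%:P) (- lam) (- mu) ('d + lam + mu).

Let fr s a (y : CHV) : M2 := at2 s (CHV_bracket a y).
Let fl s c (x : CHV) : M2 := at2 s (CHV_bracket x c).

Let frD s a : {morph fr s a : x y / x + y}.
Proof. by move=> x y; rewrite /fr CHV_bracketDr at2D. Qed.

Let frC s a (c : C) y : fr s a (c%:P *: y) = c%:P%:P%:P *: fr s a y.
Proof. by rewrite /fr CHV_bracketCr at2Z. Qed.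

Let frX s a y : fr s a ('X *: y) = ('d + s) *: fr s a y.
Proof. by rewrite /fr CHV_bracketXr scalerDl at2D at2X at2Z -scalerDl. Qed.

Let flD s a : {morph fl s a : x y / x + y}.
Proof. by move=> x y; rewrite /fl CHV_bracketDl at2D. Qed.

Let flC s a (c : C) y : fl s a (c%:P *: y) = c%:P%:P%:P *: fl s a y.
Proof. by rewrite /fl CHV_bracketCl at2Z. Qed.

Let flX s a y : fl s a ('X *: y) = - s *: fl s a y.
Proof. by rewrite /fl CHV_bracketXl !scaleNr at2N at2X. Qed.

(* [a_s [b_t c]] *)
Let Tr s t a b c : M2 := polymod_subst (fr s a) t (CHV_bracket b c).
(* [[a_t b]_s c] *)
Let Tl s t a b c : M2 := polymod_subst (fl s c) t (CHV_bracket a b).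

Let TrX1 s t b c a : Tr s t ('X *: a) b c = - s *: Tr s t a b c.
Proof. by rewrite /Tr -subst_fZ; apply: eq_subst => y; apply: flX. Qed.

Let TrX2 s t a c b : Tr s t a ('X *: b) c = - t *: Tr s t a b c.
Proof.
by rewrite /Tr CHV_bracketXl !scaleNr (substN _ (frD s a)) (substX _ (frD s a)).
Qed.

Let TrX3 s t a b c : Tr s t a b ('X *: c) = ('d + s + t) *: Tr s t a b c.
Proof.
rewrite /Tr CHV_bracketXr scalerDl (substD _ (frD s a)) (substX _ (frD s a)).
by rewrite (substZC _ (frD s a) _ (frX s a)) -scalerDl.
Qed.

Let TrD1 s t b c : {morph (fun a => Tr s t a b c) : x y / x + y}.
Proof.
by move=> x y; rewrite /Tr -subst_fD; apply: eq_subst => z; apply: flD.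
Qed.

Let TrD2 s t a c : {morph (fun b => Tr s t a b c) : x y / x + y}.
Proof. by move=> x y; rewrite /Tr CHV_bracketDl (substD _ (frD s a)). Qed.

Let TrD3 s t a b : {morph (fun c => Tr s t a b c) : x y / x + y}.
Proof. by move=> x y; rewrite /Tr CHV_bracketDr (substD _ (frD s a)). Qed.

Let TrC1 s t b c (k : C) a : Tr s t (k%:P *: a) b c = k%:P%:P%:P *: Tr s t a b c.
Proof. by rewrite /Tr -subst_fZ; apply: eq_subst => y; apply: flC. Qed.

Let TrC2 s t a c (k : C) b : Tr s t a (k%:P *: b) c = k%:P%:P%:P *: Tr s t a b c.
Proof.
by rewrite /Tr CHV_bracketCl (substZC _ (frD s a) _ (frC s a k)).
Qed.

Let TrC3 s t a b (k : C) c : Tr s t a b (k%:P *: c) = k%:P%:P%:P *: Tr s t a b c.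
Proof.
by rewrite /Tr CHV_bracketCr (substZC _ (frD s a) _ (frC s a k)).
Qed.

Let hT1 : tri_sesquilinear (Tr lam mu).
Proof.
split; [exact: TrD1|exact: TrD2|exact: TrD3|exact: TrC1|exact: TrC2|exact: TrC3
  |exact: TrX1|exact: TrX2|exact: TrX3].
Qed.

Let hT3 : tri_sesquilinear (fun a b c => Tr mu lam b a c).
Proof.
split=> *; [exact: TrD2|exact: TrD1|exact: TrD3|exact: TrC2|exact: TrC1
  |exact: TrC3|exact: TrX2|exact: TrX1|].
by rewrite TrX3 addrAC.
Qed.

Let hT2 : tri_sesquilinear (Tl (lam + mu) lam).
Proof.
split=> *.
- by move=> ? ?; rewrite /Tl CHV_bracketDl (substD _ (flD _ _)).
- by move=> ? ?; rewrite /Tl CHV_bracketDr (substD _ (flD _ _)).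
- by move=> ? ?; rewrite /Tl -subst_fD; apply: eq_subst => z; apply: frD.
- by rewrite /Tl CHV_bracketCl (substZC _ (flD _ _) _ (flC _ _ _)).
- by rewrite /Tl CHV_bracketCr (substZC _ (flD _ _) _ (flC _ _ _)).
- by rewrite /Tl -subst_fZ; apply: eq_subst => z; apply: frC.
- by rewrite /Tl CHV_bracketXl !scaleNr (substN _ (flD _ _)) (substX _ (flD _ _)).
- rewrite /Tl CHV_bracketXr scalerDl (substD _ (flD _ _)) (substX _ (flD _ _)).
  rewrite (substZC _ (flD _ _) _ (flX _ _)) -scalerDl.
  by congr (_ *: _); ring.
- by rewrite /Tl -subst_fZ; apply: eq_subst => z; rewrite -addrA; apply: frX.
Qed.

(* [e_k _x e_l] = (m d + n x) e_kl with (m, n, kl) = (cd k l, cl k l, gm k l) *)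
Let cd (k l : int + int) : nat :=
  match k with inl _ => 1 | inr _ => 0 end%N.
Let cl (k l : int + int) : nat :=
  match k, l with inl _, inl _ => 2 | inr _, inr _ => 0 | _, _ => 1 end%N.
Let gm (k l : int + int) : int + int :=
  match k, l with
  | inl i, inl j => inl (i + j)
  | inl i, inr j | inr i, inl j | inr i, inr j => inr (i + j)
  end.

Let gen_bracketE k l : CHV_gen_bracket k l =
  'X%:P *+ cd k l *: polymodC (<< gm k l >> : CHV) +
  'X *+ cl k l *: polymodC (<< gm k l >> : CHV).
Proof.
case: k l => i [] j /=; rewrite -scalerDl ?mulr1n ?mulr0n //.
  by rewrite add0r.
by rewrite addr0 scale0r.
Qed.

Let substM (f : CHV -> M2) (u t : {poly {poly {poly C}}}) k l :
  {morph f : x y / x + y} ->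
  (forall (c : C) x, f (c%:P *: x) = c%:P%:P%:P *: f x) ->
  (forall x, f ('X *: x) = u *: f x) ->
  polymod_subst f t (CHV_bracket (<< k >> : CHV) (<< l >> : CHV)) =
  (u *+ cd k l + t *+ cl k l) *: f (<< gm k l >> : CHV).
Proof.
move=> fD fC fX.
rewrite CHV_bracket_gen gen_bracketE (substD _ fD).
rewrite -(mulr_natl 'X) -(mulr_natl 'X%:P) -!polyC_natr -!scalerA.
rewrite !(substZC _ fD _ (fC _)) (substX _ fD) (substZC _ fD _ fX).
rewrite !(substC _ fD) !scalerA -scalerDl.
by congr (_ *: _); rewrite !polyC_natr !mulr_natl.
Qed.

Let frv s k l : fr s (<< k >> : CHV) (<< l >> : CHV) =
  ('d *+ cd k l + s *+ cl k l) *: CC (<< gm k l >> : CHV).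
Proof.
apply: (@substM CC 'd s k l CCD).
  by move=> c x; apply: CCZ.
by move=> x; apply: CCZ.
Qed.

Let TrE s t k l m :
  Tr s t (<< k >> : CHV) (<< l >> : CHV) (<< m >> : CHV) =
  (('d + s) *+ cd l m + t *+ cl l m) *:
    (('d *+ cd k (gm l m) + s *+ cl k (gm l m)) *:
       CC (<< gm k (gm l m) >> : CHV)).
Proof.
rewrite -frv; apply: (@substM (fr s (<< k >> : CHV)) ('d + s) t l m).
- exact: frD.
- exact: frC.
- exact: frX.
Qed.

Let TlE s t k l m :
  Tl s t (<< k >> : CHV) (<< l >> : CHV) (<< m >> : CHV) =
  ((- s) *+ cd k l + t *+ cl k l) *:
    (('d *+ cd (gm k l) m + s *+ cl (gm k l) m) *:
       CC (<< gm (gm k l) m >> : CHV)).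
Proof.
rewrite -frv; apply: (@substM (fl s (<< m >> : CHV)) (- s) t k l).
- exact: flD.
- exact: flC.
- exact: flX.
Qed.

Let jacobi_coef (S : comNzRingType) (d s t : S) k l m :
  ((d + s) *+ cd l m + t *+ cl l m) *
    (d *+ cd k (gm l m) + s *+ cl k (gm l m)) =
  ((- (s + t)) *+ cd k l + s *+ cl k l) *
    (d *+ cd (gm k l) m + (s + t) *+ cl (gm k l) m) +
  ((d + t) *+ cd k m + s *+ cl k m) *
    (d *+ cd l (gm k m) + t *+ cl l (gm k m)).
Proof. by case: k l m => i [] j [] n /=; ring. Qed.

Lemma CHV_bracket_jacobi : conf_jacobi CHV_bracket.
Proof.
move=> a b c; apply: (tri_sesquilinear_ext hT1 (tri_sesquilinearD hT2 hT3)).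
move=> {a b c} k l m.
rewrite TrE TlE TrE !scalerA.
have e1 : gm k (gm l m) = gm (gm k l) m.
  by case: k l m => i [] j [] n /=; rewrite addrA.
have e2 : gm l (gm k m) = gm (gm k l) m.
  by rewrite -e1 {e1}; case: k l m => i [] j [] n /=; rewrite addrCA.
rewrite e1 e2 -scalerDl; congr (_ *: _).
exact: jacobi_coef.
Qed.

HB.instance Definition _ := isLieConformal.Build C CHV
  CHV_bracket_linearl CHV_bracket_linearr CHV_bracket_sesquilinear
  CHV_bracket_skew CHV_bracket_jacobi.

(* The values on the basis L_i, H_i are extended by D(d v) = (d + x) D(v). *)
Definition CHV_D (a : {malg C[int]}) : CHV -> polymod CHV :=
  CHV_ext ('X%:P + 'X) (fun k =>
    match k with
    | inl i => \sum_(c <- msupp a) (a@_c)%:P%:P *: polymodC (CHV_H (i + c))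
    | inr _ => 0
    end).

Lemma CHV_D_L a i : CHV_D a (CHV_L i) =
  \sum_(c <- msupp a) (a@_c)%:P%:P *: polymodC (CHV_H (i + c)).
Proof. exact: CHV_ext_gen. Qed.

Lemma CHV_D_H a i : CHV_D a (CHV_H i) = 0.
Proof. exact: CHV_ext_gen. Qed.

End CHV.

(* Main.v *)
Require Import Defs.
From HB Require Import structures.
From mathcomp Require Import all_boot all_order all_algebra.
From mathcomp Require Import finmap monalg.
From mathcomp Require Import boolp classical_sets reals complex.
Set Implicit Arguments.
Unset Strict Implicit.
Import GRing.Theory.
Local Open Scope ring_scope.
Local Open Scope classical_set_scope.

(** Write x for the variable of the bracket. As [L_0 _0 b] = d b for all b, the
    mu-constant term of the derivation rule for [L_0 _mu b] says that x phi = ad_y,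
    where y is phi(L_0) evaluated at x = -d. Conversely, as x acts injectively,
    every phi with x phi = ad_y for some y is a conformal derivation, by the
    Jacobi identity. Write y = - d z + h + l with h and l constant combinations
    of the H_i and of the L_i. The constant term of [y _x L_0] is d l, so l = 0;
    and ad_(-d z) = x ad_z while ad_h = x D_a for a the coefficients of h. Hence
    phi = ad_z + D_a. The sum is direct since the constant term of ad_z(L_0)
    has no component on the H_c, where that of D_a(L_0) has a_c. *)

(** * Constant terms in [polymod V], and injectivity of multiplication by a variable *)

Section PolymodCoef.
Variables (K : comNzRingType) (V : lmodType K).
Implicit Types (v w : polymod V) (s : {poly K}).

(* Unlike in v@_0, the type V here carries its module structure. *)
Definition const_coef v : V := v@_0%N.

Lemma const_coefD v w : const_coef (v + w) = const_coef v + const_coef w.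
Proof. exact: pcoefD. Qed.

Lemma const_coef0 : const_coef 0 = 0.
Proof. exact: pcoef0. Qed.

Lemma const_coefZ s v : const_coef (s *: v) = s`_0 *: const_coef v.
Proof. by rewrite [LHS]pcoef_scale big_ord1. Qed.

Lemma const_coefC (u : V) : const_coef (polymodC u) = u.
Proof. exact: mcoeffUU. Qed.

Lemma const_coef_sum (I : Type) (r : seq I) (F : I -> polymod V) :
  const_coef (\sum_(i <- r) F i) = \sum_(i <- r) const_coef (F i).
Proof. exact: (big_morph _ const_coefD const_coef0). Qed.

Lemma pcoefCZ (p : K) v n : (p%:P *: v)@_n = p *: v@_n.
Proof.
rewrite [LHS]pcoef_scale big_ord_recl big1 ?addr0 => [|i _].
  by rewrite coefC eqxx subn0.
by rewrite coefC scale0r.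
Qed.

Lemma pcoefXZ v n : ('X *: v)@_n.+1 = v@_n.
Proof.
rewrite [LHS]pcoef_scale (bigD1 (lift ord0 ord0)) //= big1 => [|i].
  by rewrite coefX scale1r addr0 subSS subn0.
by rewrite coefX -val_eqE /= => /negbTE ->; rewrite scale0r.
Qed.

Lemma scaleX_inj : injective (fun v => 'X *: v).
Proof.
move=> v w e; apply: polymodP => n.
by rewrite -[LHS]pcoefXZ -[RHS]pcoefXZ; congr (mcoeff _ _).
Qed.

(** Evaluation at 0 is a ring morphism on scalars, so it passes through the powers of [s]. *)
Lemma const_coef_subst (L : comNzRingType) (U : lmodType L) (f : U -> polymod V)
    (g : U -> V) s t (x : polymod U) :
  (forall u, const_coef (f u) = g u) -> s`_0 = t ->
  const_coef (polymod_subst f s x) = polymod_subst g t x.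
Proof.
move=> fg <-; rewrite /polymod_subst const_coef_sum; apply: eq_bigr => n _.
by rewrite const_coefZ fg -!horner_coef0 horner_exp.
Qed.

End PolymodCoef.

Lemma scaleXC_inj (K : comNzRingType) (W : lmodType {poly K}) :
  injective (fun u : W => 'X *: u) ->
  injective (fun v : polymod W => 'X%:P *: v).
Proof.
move=> XI v w e; apply: polymodP => n; apply: XI => /=.
by rewrite -[LHS]pcoefCZ -[RHS]pcoefCZ; congr (mcoeff _ _).
Qed.

Lemma subst_at0 (K S : comNzRingType) (V : lmodType K) (M : lmodType S)
    (f : V -> M) (x : polymod V) :
  {morph f : v w / v + w} -> polymod_subst f 0 x = f (const_coef x).
Proof.
move=> fD; rewrite (@substw _ _ _ _ _ _ fD (0%N |` msupp (x : {malg V[nat]}))%fset).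
  rewrite (big_fsetD1 0%N) ?fset1U1 //= expr0 scale1r big_seq big1 ?addr0 //.
  by move=> n; rewrite in_fsetD1 => /andP[n0 _]; rewrite expr0n (negbTE n0) scale0r.
exact: fsubsetUr.
Qed.

Section ConfLinear.
Variables (C : fieldType) (A : lmodType {poly C}) (phi : A -> polymod A).
Hypothesis phi_lin : conf_linear phi.

Lemma conf_linearD : {morph phi : v w / v + w}.
Proof. by move=> v w; have := phi_lin 1 v w; rewrite !scale1r. Qed.

Lemma conf_linear0 : phi 0 = 0.
Proof. by apply: (addrI (phi 0)); rewrite -conf_linearD !addr0. Qed.

Lemma conf_linearN v : phi (- v) = - phi v.
Proof. by apply/eqP; rewrite -addr_eq0 -conf_linearD addNr conf_linear0. Qed.

Lemma conf_linear_sum I (r : seq I) (F : I -> A) :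
  phi (\sum_(i <- r) F i) = \sum_(i <- r) phi (F i).
Proof. exact: (big_morph _ conf_linearD conf_linear0). Qed.

End ConfLinear.

Lemma polymodE (K : comNzRingType) (V : lmodType K) (z : polymod V) :
  polymod_subst (@polymodC K V) 'X z = z.
Proof.
rewrite [RHS](monalgE (z : {malg V[nat]})); apply: eq_bigr => n _.
have := polymod_scaleU (1 : K) n (z@_n) 0%N.
by rewrite addn0 scale1r mul1r.
Qed.

Section At2.
Variables (C : fieldType) (A : lmodType {poly C}).

(** The constant term is in the outer variable [mu]: [lam] and [lam + mu] become ['X], and [mu]
    becomes 0. *)
Lemma const_coef_at2 (s : {poly {poly {poly C}}}) (z : polymod A) :
  const_coef (at2 s z) = polymod_subst (@polymodC _ A) s`_0 z.
Proof. by apply: const_coef_subst => // v; apply: const_coefC. Qed.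

Lemma at2X (s : {poly {poly {poly C}}}) (z : polymod A) :
  at2 s ('X *: z) = s *: at2 s z.
Proof. by apply: substX => v w; rewrite !polymodCD. Qed.

Lemma at2D (s : {poly {poly {poly C}}}) :
  {morph @at2 C A s : v w / v + w}.
Proof. by apply: substD => v w; rewrite !polymodCD. Qed.

End At2.

(** * Derivations whose multiple by the variable is inner, in any Lie conformal algebra *)

Section AdDivision.
Variables (C : fieldType) (A : lieConformalType C).
Implicit Types (x y z b : A).

Lemma lbracketDl b : {morph (fun x => lbracket x b) : x y / x + y}.
Proof. exact: conf_linearD (lbracket_linearl b). Qed.

Lemma lbracketDr x : {morph (fun b => lbracket x b) : b c / b + c}.
Proof. exact: conf_linearD (lbracket_linearr x). Qed.

Lemma lbracketXl x b : lbracket ('X *: x) b = - 'X *: lbracket x b.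
Proof. exact: lbracket_sesquilinear.1. Qed.

Lemma lbracketXr x b : lbracket x ('X *: b) = ('X%:P + 'X) *: lbracket x b.
Proof. exact: lbracket_sesquilinear.2. Qed.

(** By sesquilinearity, [- 'X] in the left argument acts as ['X] outside the bracket. *)
Lemma lbracket_subst (z : polymod A) b :
  lbracket (polymod_subst (fun v : A => v) (- 'X) z) b =
  polymod_subst (fun x => lbracket x b) 'X z.
Proof.
rewrite /polymod_subst (conf_linear_sum (lbracket_linearl b)).
apply: eq_bigr => n _; elim: n (z@_n) => [|n IH] v.
  by rewrite !expr0 !scale1r.
rewrite !exprS -!scalerA -IH scaleNr (conf_linearN (lbracket_linearl b)).
by rewrite lbracketXl scaleNr opprK.
Qed.

Lemma derivation_of_ad (phi : A -> polymod A) y :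
  (forall v, 'X *: phi v = lbracket y v) -> conformal_derivation phi.
Proof.
move=> phiE; split.
- move=> c v w; apply: scaleX_inj; rewrite /= phiE lbracket_linearr -!phiE.
  by rewrite scalerDr !scalerA mulrC.
- move=> v; apply: scaleX_inj; rewrite /= phiE lbracketXr -phiE.
  by rewrite !scalerA mulrC.
(* The factor cancelled is [lam]. On the right it is absorbed by the substitution at [lam], on the
   left by [at2 lam]; every [phi] then turns into a bracket with [y], and the Jacobi identity
   remains. *)
move=> a b; apply: (@scaleXC_inj _ (polymod A) (@scaleX_inj _ A)) => /=.
have subX (F : A -> polymod (polymod A)) (z : polymod A) : {morph F : v w / v + w} ->
    'X%:P *: polymod_subst F lam z = polymod_subst F lam ('X *: z).
  by move=> FD; rewrite substX.

have e1 := subX (fun x => at2 (lam + mu) (lbracket x b)) (phi a).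
have e2 := subX (fun v => at2 mu (lbracket a v)) (phi b).
rewrite scalerDr [X in _ = X + _]e1; last by move=> v w; rewrite lbracketDl at2D.
rewrite [X in _ = _ + X]e2; last by move=> v w; rewrite lbracketDr at2D.
rewrite !phiE -lbracket_jacobi -subst_fZ; apply: eq_subst => v.
by rewrite -phiE at2X.
Qed.

Lemma ad_of_derivation (phi : A -> polymod A) e :
  (forall b, const_coef (lbracket e b) = 'X *: b) -> conformal_derivation phi ->
  forall b, 'X *: phi b =
    lbracket (polymod_subst (fun v : A => v) (- 'X) (phi e)) b.
Proof.
move=> eX [phi_lin phiX phi_br] b.
(* Next come the [mu]-constant terms of the three members of the derivation rule for [e] and [b]. *)
have phi0 (z : polymod A) :
    const_coef (polymod_subst (fun y => at2 lam (phi y)) mu z) = phi (const_coef z).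
  rewrite (const_coef_subst (g := phi) (t := 0)) ?subst_at0 ?coefX //.
    exact: conf_linearD.
  by move=> v; rewrite const_coef_at2 /lam coefC eqxx polymodE.
have ad_e (z : polymod A) :
    const_coef (polymod_subst (fun x => at2 (lam + mu) (lbracket x b)) lam z) =
    polymod_subst (fun x => lbracket x b) 'X z.
  apply: const_coef_subst => [v|]; last by rewrite coefC.
  by rewrite const_coef_at2 /lam /mu coefD coefC coefX eqxx addr0 polymodE.
have e_phi (z : polymod A) :
    const_coef (polymod_subst (fun y => at2 mu (lbracket e y)) lam z) = 'X%:P *: z.
  rewrite (const_coef_subst (g := fun y => 'X%:P *: polymodC y) (t := 'X)).
  - by rewrite subst_fZ polymodE.
  - move=> v; rewrite const_coef_at2 /mu coefX subst_at0; last exact: polymodCD.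
    by rewrite eX polymodCZ.
  - by rewrite coefC.
(* Since [phi ('X *: b)] is [('X%:P + 'X) *: phi b], the terms ['X%:P *: phi b] cancel. *)
have := congr1 (@const_coef _ _) (phi_br e b).
rewrite const_coefD => /(etrans (esym (phi0 _))).
rewrite [X in _ = X + _ -> _]ad_e [X in _ = _ + X -> _]e_phi.
rewrite eX phiX scalerDl addrC lbracket_subst; exact: addIr.
Qed.

End AdDivision.

(** * Rearrangements of the form -pz + h + l used in [CHV_split] *)

Section Lmodule.
Variables (K : comNzRingType) (M : lmodType K).
Implicit Types (p q : K) (z h l : M).

Lemma addr_split p z z' h h' l l' :
  - (p *: z) + h + l + (- (p *: z') + h' + l') =
  - (p *: (z + z')) + (h + h') + (l + l').
Proof. by rewrite addrACA (addrACA _ h) -opprD -scalerDr. Qed.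

Lemma scaler_comm p q z : p *: (q *: z) = q *: (p *: z).
Proof. by rewrite !scalerA mulrC. Qed.

Lemma scaler_split p q z h l :
  p *: (- (q *: z) + h + l) = - (q *: (p *: z)) + p *: h + p *: l.
Proof. by rewrite !scalerDr scalerN scaler_comm. Qed.

End Lmodule.

(* [{malg C[int]}] is an lmodType over C, but its image is taken in modules over
   polynomial rings, where C acts through the morphism h. *)
Lemma malg_sum_linear (C S : comNzRingType) (M : lmodType S) (h : {rmorphism C -> S})
    (F : int -> M) (c : C) (a b : {malg C[int]}) :
  \sum_(i <- msupp (c *: a + b)) h (c *: a + b)@_i *: F i =
  h c *: (\sum_(i <- msupp a) h a@_i *: F i) + \sum_(i <- msupp b) h b@_i *: F i.
Proof.
pose d := (msupp (c *: a + b) `|` (msupp a `|` msupp b))%fset.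
have supp (g : {malg C[int]}) : (msupp g `<=` d)%fset ->
    \sum_(i <- msupp g) h g@_i *: F i = \sum_(i <- d) h g@_i *: F i.
  move=> gd; apply: (sum_msupp (F := fun i v => h v *: F i)) => // k.
  by rewrite rmorph0 scale0r.
have sa : (msupp a `<=` d)%fset.
  exact: fsubset_trans (fsubsetUl _ _) (fsubsetUr _ _).
have sb : (msupp b `<=` d)%fset.
  exact: fsubset_trans (fsubsetUr _ _) (fsubsetUr _ _).
rewrite !supp ?fsubsetUl // scaler_sumr -big_split; apply: eq_bigr => i _ /=.
by rewrite mcoeffD mcoeffZ rmorphD rmorphM scalerDl scalerA.
Qed.

(** * The loop Heisenberg-Virasoro case *)

Section CHVDerivations.
Variable C : fieldType.
Local Notation CHV := (CHV C).
Implicit Types (a b : {malg C[int]}) (x y z v : CHV).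

(** As the coefficients are constants, the sums for [CHV_H] and [CHV_L] together represent the
    classes modulo ['X]. *)
Definition CHV_comb (e : int -> CHV) a : CHV :=
  \sum_(i <- msupp a) (a@_i)%:P *: e i.

Lemma CHV_comb_linear e (c : C) a b :
  CHV_comb e (c *: a + b) = c%:P *: CHV_comb e a + CHV_comb e b.
Proof. exact: (malg_sum_linear polyC). Qed.

Lemma CHV_combD e a b : CHV_comb e (a + b) = CHV_comb e a + CHV_comb e b.
Proof. by have := CHV_comb_linear e 1 a b; rewrite !scale1r. Qed.

Lemma CHV_comb0 e : CHV_comb e 0 = 0.
Proof. by rewrite /CHV_comb msupp0 big_nil. Qed.

Lemma CHV_combZ e (c : C) a : CHV_comb e (c *: a) = c%:P *: CHV_comb e a.
Proof. by have := CHV_comb_linear e c a 0; rewrite CHV_comb0 !addr0. Qed.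

Lemma CHV_combU e i : CHV_comb e << i >> = e i.
Proof.
rewrite /CHV_comb msuppU oner_eq0 big_seq_fset1 mcoeffU eqxx.
by rewrite scale1r.
Qed.

Lemma CHV_scaleX_inj : injective (fun v : CHV => 'X *: v).
Proof.
move=> v w /= /malgP e; apply/malgP => k; have := e k.
by rewrite (mcoeffZ 'X) (mcoeffZ 'X); apply: mulfI; rewrite polyX_eq0.
Qed.

(** The sign makes the bracket with the first summand equal to ['X] times the bracket with [z]. *)
Lemma CHV_split y : exists z a b,
  y = - ('X *: z) + CHV_comb (@CHV_H C) a + CHV_comb (@CHV_L C) b.
Proof.
have E0 : - ('X *: (0 : CHV)) = 0 by rewrite scaler0 oppr0.
elim/CHV_ind: y => [|x y [z [a [b ->]]] [z' [a' [b' ->]]]|c x [z [a [b ->]]]|x _|i|i].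
- by exists 0, 0, 0; rewrite !CHV_comb0 E0 !addr0.
- by exists (z + z'), (a + a'), (b + b'); rewrite !CHV_combD; exact: addr_split.
- by exists (c%:P *: z), (c *: a), (c *: b); rewrite !CHV_combZ; exact: scaler_split.
- by exists (- x), 0, 0; rewrite !CHV_comb0 scalerN opprK !addr0.
- by exists 0, 0, << i >>; rewrite CHV_comb0 CHV_combU E0 !add0r.
- by exists 0, << i >>, 0; rewrite CHV_comb0 CHV_combU E0 add0r addr0.
Qed.

(** This lets [CHV_L 0] serve as [e] in [ad_of_derivation]. *)
Lemma CHV_bracket_L0 v : const_coef (CHV_bracket (CHV_L C 0) v) = 'X *: v.
Proof.
move: v; apply: (@CHV_linear_ext _ {poly C} _ _ _ polyC 'X) => [v w|v w|c v|c v|v|v|i|i].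
- by rewrite CHV_bracketDr const_coefD.
- exact: scalerDr.
- by rewrite CHV_bracketCr const_coefZ coefC.
- exact: scaler_comm.
- by rewrite CHV_bracketXr const_coefZ coefD coefC coefX addr0.
- by [].
- rewrite CHV_bracketLL const_coefZ const_coefC add0r.
  by rewrite coefD coefC coefMn coefX mul0rn addr0.
- by rewrite CHV_bracketLH const_coefZ const_coefC add0r coefD coefC coefX addr0.
Qed.

Lemma CHV_bracket_sum (I : Type) (r : seq I) (F : I -> CHV) v :
  CHV_bracket (\sum_(i <- r) F i) v = \sum_(i <- r) CHV_bracket (F i) v.
Proof. exact: (conf_linear_sum (CHV_bracket_linearl v)). Qed.

Lemma CHV_bracket_comb e a v :
  CHV_bracket (CHV_comb e a) v =
  \sum_(i <- msupp a) (a@_i)%:P%:P *: CHV_bracket (e i) v.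
Proof.
by rewrite CHV_bracket_sum; apply: eq_bigr => i _; rewrite CHV_bracketCl.
Qed.

Lemma CHV_bracket_combL_L0 b :
  const_coef (CHV_bracket (CHV_comb (@CHV_L C) b) (CHV_L C 0)) =
  'X *: CHV_comb (@CHV_L C) b.
Proof.
rewrite CHV_bracket_comb const_coef_sum scaler_sumr; apply: eq_bigr => i _.
rewrite const_coefZ coefC /= CHV_bracketLL const_coefZ const_coefC addr0.
by rewrite coefD coefC coefMn coefX /= mul0rn addr0 !scalerA mulrC.
Qed.

Lemma CHV_D_linear (c : C) a b v :
  CHV_D (c *: a + b) v = c%:P%:P *: CHV_D a v + CHV_D b v.
Proof.
rewrite /CHV_D -CHV_extfZ -CHV_extfD; apply: eq_CHV_ext => -[i|i].
  pose F j := polymodC (CHV_H C (i + j)).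
  exact: (malg_sum_linear (polyC \o polyC) F c a b).
by rewrite scaler0 addr0.
Qed.

(** Both sides are sesquilinear in [v] in the same way; on generators the factor ['X] is the one in
    [CHV_bracketHL]. *)
Lemma scaleX_CHV_D a v : 'X *: CHV_D a v = CHV_bracket (CHV_comb (@CHV_H C) a) v.
Proof.
move: v; apply: (@CHV_linear_ext _ {poly {poly C}} _ _ _
    (fun c => c%:P%:P) ('X%:P + 'X)) => [||c x|c x|x|x|i|i].
- by move=> x y; rewrite /CHV_D CHV_extD scalerDr.
- exact: CHV_bracketDr.
- by rewrite /CHV_D CHV_extZ subdC !scalerA mulrC.
- exact: CHV_bracketCr.
- by rewrite /CHV_D CHV_extZ subdX !scalerA mulrC.
- exact: CHV_bracketXr.
- rewrite CHV_D_L CHV_bracket_comb scaler_sumr; apply: eq_bigr => j _.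
  by rewrite CHV_bracketHL addrC !scalerA mulrC.
- rewrite CHV_D_H CHV_bracket_comb scaler0 big1 // => j _.
  by rewrite CHV_bracketHH scaler0.
Qed.

Lemma CHV_ad_D z a v :
  'X *: (CHV_bracket z v + CHV_D a v) =
  CHV_bracket (- ('X *: z) + CHV_comb (@CHV_H C) a) v.
Proof.
rewrite CHV_bracketDl -scaleX_CHV_D scalerDr; congr (_ + _).
by rewrite (conf_linearN (CHV_bracket_linearl v)) CHV_bracketXl scaleNr opprK.
Qed.

Lemma CHV_derivationP (phi : CHV -> polymod CHV) :
  conformal_derivation phi <->
  exists z a, phi = fun v => CHV_bracket z v + CHV_D a v.
Proof.
split=> [phiD|[z [a ->]]]; last first.
  apply: derivation_of_ad => v; exact: CHV_ad_D.
have := ad_of_derivation CHV_bracket_L0 phiD.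
move: (polymod_subst _ _ _) => y; have [z [a [b ->]]] := CHV_split y => phiE.
(* At [CHV_L 0], both ['X *: phi] and the part of the bracket from [z] and [a] are multiples of the
   variable, so only the [b] part has a constant term. *)
have b0 : CHV_comb (@CHV_L C) b = 0.
  apply: CHV_scaleX_inj; rewrite /= scaler0 -CHV_bracket_combL_L0.
  have := congr1 (@const_coef _ _) (phiE (CHV_L C 0)) => /=.
  rewrite const_coefZ coefX /= scale0r => /esym.
  rewrite [lbracket _ _]CHV_bracketDl const_coefD -CHV_ad_D const_coefZ.
  by rewrite coefX /= scale0r add0r.
exists z, a; apply/funext => v; apply: scaleX_inj => /=.
by rewrite phiE b0 addr0 CHV_ad_D.
Qed.

(** The comparison is with the zero map, on which ['X] acts as 0: in the left argument it yields the
    factor [- 'X], without constant term. *)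
Lemma CHV_ad_L0_coefH z c : (const_coef (CHV_bracket z (CHV_L C 0)))@_(inr c) = 0.
Proof.
move: z; apply: (@CHV_linear_ext _ {poly C} {poly C}^o _ (fun=> 0) polyC 0)
  => [z z'|z z'|k z|k z|z|z|i|i].
- by rewrite CHV_bracketDl const_coefD mcoeffD.
- by rewrite addr0.
- by rewrite CHV_bracketCl const_coefZ coefC mcoeffZ.
- by rewrite scaler0.
- by rewrite CHV_bracketXl const_coefZ coefN coefX oppr0 !scale0r mcoeff0.
- by rewrite scaler0.
- by rewrite CHV_bracketLL const_coefZ const_coefC mcoeffZ mcoeffU mulr0.
- by rewrite CHV_bracketHL const_coefZ coefX scale0r mcoeff0.
Qed.

(** Reading [a] off its derivation gives both injectivity and directness of the sum. *)
Lemma CHV_D_L0_coefH a c : (const_coef (CHV_D a (CHV_L C 0)))@_(inr c) = (a@_c)%:P.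
Proof.
rewrite CHV_D_L const_coef_sum (raddf_sum (@mcoeff _ {poly C} (inr c))) /=.
under eq_bigr do rewrite const_coefZ coefC /= const_coefC add0r mcoeffZ mcoeffU.
have [ca|ca] := boolP (c \in msupp a).
  rewrite (big_fsetD1 c) //= eqxx mulr1 big_seq big1 ?addr0 // => i.
  rewrite in_fsetD1 => /andP[ic _].
  by rewrite [_ == _](negbTE ic) mulr0.
rewrite (mcoeff_outdom ca) polyC0 big_seq big1 // => i ia.
rewrite [_ == _](_ : _ = false) ?mulr0 //.
by apply: contraNF ca => /eqP[<-].
Qed.

Lemma CHV_D_inj : injective (@CHV_D C).
Proof.
move=> a b ab; apply/malgP => c; apply: polyC_inj.
by rewrite -!CHV_D_L0_coefH ab.
Qed.

Lemma CHV_D0 : CHV_D 0 = fun=> 0 :> polymod CHV.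
Proof.
apply/funext => v; apply: scaleX_inj.
by rewrite /= scaler0 scaleX_CHV_D CHV_comb0 (conf_linear0 (CHV_bracket_linearl v)).
Qed.

End CHVDerivations.

(** The first two clauses justify identifying finitely supported sequences with their
    derivations. *)
Theorem theorem4p3 (R : realType) :
  [/\ forall (c : R[i]) (a b : {malg R[i][int]}) (v : CHV R[i]),
        CHV_D (c *: a + b) v = c%:P%:P *: CHV_D a v + CHV_D b v,
      injective (@CHV_D R[i]) &
      direct_sum (CDer (CHV R[i])) (CInn (CHV R[i]))
        [set CHV_D a | a in [set: {malg R[i][int]}]]].
Proof.
split; [exact: CHV_D_linear|exact: CHV_D_inj|split].
- split; first by exists 0 => //; apply/funext => v; apply: conf_linear0;
    apply: lbracket_linearl.
  move=> c _ _ [x _ <-] [y _ <-]; exists (c%:P *: x + y) => //.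
  by apply/funext => v; apply: lbracket_linearl.
- split; first by exists 0 => //; apply: CHV_D0.
  move=> c _ _ [a _ <-] [b _ <-]; exists (c *: a + b) => //.
  by apply/funext => v; apply: CHV_D_linear.
- apply/seteqP; split=> [phi /CHV_derivationP[z [a ->]]|_ [_ [z _ <-] [_ [a _ <-] <-]]].
    by exists (conf_ad z); [exists z|exists (CHV_D a); first exists a].
  by apply/CHV_derivationP; exists z, a.
- apply/seteqP; split=> [_ [[z _ <-] [a _ az]]|_ ->]; last first.
    split; last by exists 0 => //; apply: CHV_D0.
    by exists 0 => //; apply/funext => v; apply: conf_linear0; apply: lbracket_linearl.
  suff a0 : a = 0 by rewrite /= -az a0 CHV_D0.
  apply/malgP => c; apply: polyC_inj.
  by rewrite -CHV_D_L0_coefH az mcoeff0 polyC0; apply: CHV_ad_L0_coefH.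
Qed.
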